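(* Let $m,n,n',r,r',s$ be positive integers with $mr'$ even. Suppose there exists a shiftable $SMR(m,n;r,s)$ and there exists an $SMR(m,n';r',s)$. Then for every integer $k\geq 1$ there exists an $SMR(m,kn+n';kr+r',s)$; moreover, if the given $SMR(m,n';r',s)$ is shiftable, then there exists a shiftable $SMR(m,kn+n';kr+r',s)$.
   Context: A signed magic rectangle $SMR(m,n;r,s)$ is an $m\times n$ array, some of whose cells are filled with integers and the others empty, such that exactly $r$ cells in every row and exactly $s$ cells in every column are filled (so $mr=ns$), every element of a set $X$ appears exactly once in the array, and the sum of the entries of each row and of each column is zero. Here $X=\{\pm1,\pm2,\ldots,\pm mr/2\}$ if $mr$ is even, and $X=\{0,\pm1,\ldots,\pm (mr-1)/2\}$ if $mr$ is odd. An array is shiftable if every row and every column contains the same number of positive entries as negative entries. *)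

(* Defs.v *)
From mathcomp Require Import all_boot all_order all_algebra.

Set Implicit Arguments.
Unset Strict Implicit.
Unset Printing Implicit Defensive.

Import Order.TTheory GRing.Theory Num.Theory.
Local Open Scope ring_scope.

(* The set X attached to an array with N filled cells: {±1, ..., ±N/2} if N is
   even, {0, ±1, ..., ±(N-1)/2} if N is odd. *)
Definition smr_symbols (N : nat) : pred int :=
  [pred x : int | if odd N then (`|x| <= N.-1./2)%N
                  else (1 <= `|x| <= N./2)%N].

(* An m x n array is an option-valued matrix; None is an empty cell. *)
Section Arrays.

Variables m n : nat.
Implicit Types (A : 'M[option int]_(m, n)) (i : 'I_m) (j : 'I_n).

Definition entry_pos A i j : bool := if A i j is Some x then 0 < x else false.
Definition entry_neg A i j : bool := if A i j is Some x then x < 0 else false.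

(* Empty cells contribute 0 to the sums. That every entry lies in
   smr_symbols (m * r) follows by counting the filled cells. *)
Definition is_SMR (r s : nat) A : Prop :=
  [/\ forall i, #|[set j | A i j != None]| = r,
      forall j, #|[set i | A i j != None]| = s,
      forall x : int, x \in smr_symbols (m * r) ->
        #|[set p : 'I_m * 'I_n | A p.1 p.2 == Some x]| = 1%N,
      forall i, \sum_j odflt 0 (A i j) = 0
    & forall j, \sum_i odflt 0 (A i j) = 0].

Definition shiftable A : Prop :=
  (forall i, #|[set j | entry_pos A i j]| = #|[set j | entry_neg A i j]|) /\
  (forall j, #|[set i | entry_pos A i j]| = #|[set i | entry_neg A i j]|).

End Arrays.

(* Main.v *)
Require Import Defs.
From mathcomp Require Import all_boot all_order all_algebra.
From mathcomp Require Import zify.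

(** Adding [d] to the positive entries and subtracting [d] from the negative
    entries of a shiftable array preserves all row and column sums. With
    [d = m * r' / 2], the absolute values in the shifted copy of [A] follow on
    those in [B], so juxtaposing the two arrays gives a signed magic rectangle;
    iterate this [k] times. The set of symbols only splits in this way if
    [m * r] is even. Otherwise [r] is odd, so shiftability puts a [0] in every
    row of [A] and [m = 1]; but then the column sums force all entries of [B]
    to be [0], while [1] occurs in [B]. *)

Set Implicit Arguments.
Unset Strict Implicit.
Unset Printing Implicit Defensive.

Import Order.TTheory GRing.Theory Num.Theory.
Local Open Scope ring_scope.

Definition shift_entry (d : nat) (u : option int) : option int :=
  omap (fun x => x + Num.sg x * d%:Z) u.

Lemma shift_entry_eqNone d u : (shift_entry d u == None) = (u == None).
Proof. by case: u. Qed.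

Lemma shift_entry_pos d u :
  oapp (fun x => 0 < x) false (shift_entry d u) = oapp (fun x => 0 < x) false u.
Proof. by case: u => [x|] //=; case: sgrP => hx; lia. Qed.

Lemma shift_entry_neg d u :
  oapp (fun x => x < 0) false (shift_entry d u) = oapp (fun x => x < 0) false u.
Proof. by case: u => [x|] //=; case: sgrP => hx; lia. Qed.

(** The index type is an arbitrary [finType], so that one statement serves both rows and columns. *)
Lemma sum_shift_entry d (I : finType) (f : I -> option int) :
  #|[set i | oapp (fun x => 0 < x) false (f i)]| =
  #|[set i | oapp (fun x => x < 0) false (f i)]| ->
  \sum_i odflt 0 (shift_entry d (f i)) = \sum_i odflt 0 (f i).
Proof.
move=> eq_pn.
have sum_bool (P : pred I) : \sum_i (P i)%:R = #|[set i | P i]|%:R :> int.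
  rewrite -sum1dep_card natr_sum [RHS]big_mkcond.
  by apply: eq_bigr => i _; case: (P i).
pose pos i := oapp (fun x : int => 0 < x) false (f i).
pose neg i := oapp (fun x : int => x < 0) false (f i).
(* The sign of an entry is [pos - neg], including for zero and empty cells, so the total change is
   [d] times the difference of the two counts. *)
transitivity (\sum_i (odflt 0 (f i) + ((pos i)%:R - (neg i)%:R) * d%:Z)).
  apply: eq_bigr => i _; rewrite /pos /neg.
  by case: (f i) => [x|] /=; [case: sgrP; lia | lia].
by rewrite big_split /= -mulr_suml sumrB !sum_bool eq_pn subrr mul0r addr0.
Qed.

Lemma card_split_ord n n' (P : pred 'I_(n + n')) :
  #|[set j | P j]| =
  (#|[set j | P (lshift n' j)]| + #|[set j | P (rshift n j)]|)%N.
Proof. by rewrite -!sum1dep_card big_split_ord. Qed.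

Lemma card_cells m n (P : 'I_m -> 'I_n -> bool) r :
  (forall i, #|[set j | P i j]| = r) -> #|[set p | P p.1 p.2]| = (m * r)%N.
Proof.
move=> card_row.
rewrite -sum1dep_card -(pair_big_dep xpredT P (fun _ _ => 1%N)) /=.
under eq_bigr => i _ do rewrite sum1dep_card card_row.
by rewrite sum_nat_const card_ord.
Qed.

(* Pigeonhole: an array with [h.*2] filled cells cannot repeat a symbol if all
   [h.*2] symbols occur in it. *)
Lemma symbols_once m n h (A : 'M[option int]_(m, n)) :
  #|[set p | A p.1 p.2 != None]| = h.*2 ->
  (forall x, x \in smr_symbols h.*2 -> exists p, A p.1 p.2 = Some x) ->
  forall x, x \in smr_symbols h.*2 ->
    #|[set p : 'I_m * 'I_n | A p.1 p.2 == Some x]| = 1%N.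
Proof.
move=> filledA occA x xX.
(* [Negz i] is [-(i + 1)], so the two halves of [S] are told apart by their constructors. *)
pose S : seq int := [seq i.+1%:Z | i <- iota 0 h] ++ [seq Negz i | i <- iota 0 h].
have sizeS : size S = h.*2 by rewrite size_cat !size_map size_iota addnn.
have uniqS : uniq S.
  rewrite cat_uniq !map_inj_uniq ?iota_uniq //=; try by move=> i j; case.
  by rewrite andbT; apply/hasPn => _ /mapP[i _ ->]; apply/mapP => -[].
have subS y : y \in S -> y \in smr_symbols h.*2.
  rewrite mem_cat inE odd_double doubleK.
  by case/orP=> /mapP[i]; rewrite mem_iota => hi ->; lia.
pose f (p : 'I_m * 'I_n) := A p.1 p.2.
pose F := [set p | f p != None].
have inj_f : {in F &, injective f}.
  (* The image list of [f] on [F] has length [h.*2] and contains the [h.*2] distinct values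
     [map Some S], so it has no repetition. *)
  apply/dinjectiveP; apply: (@leq_size_uniq _ (map Some S)).
  - by rewrite map_inj_uniq // => ? ? [].
  - move=> _ /mapP[y yS ->]; have [p pE] := occA y (subS y yS).
    by rewrite -pE; apply: (image_f f); rewrite inE /f pE.
  - by rewrite size_image filledA size_map sizeS.
have [p pE] := occA x xX.
rewrite -(cards1 p); congr #|pred_of_set _|; apply/setP => q; rewrite !inE.
apply/eqP/eqP => [qE|-> //].
by apply: inj_f; rewrite ?inE /f ?qE ?pE.
Qed.

Lemma SMR_symbol_occurs m n r s (A : 'M[option int]_(m, n)) x :
  is_SMR r s A -> x \in smr_symbols (m * r) -> exists p, A p.1 p.2 = Some x.
Proof.
case=> _ _ onceA _ _ /onceA cardx.
have /card_gt0P[p] : (0 < #|[set p | A p.1 p.2 == Some x]|)%N by rewrite cardx.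
by rewrite inE => /eqP; exists p.
Qed.

Lemma shiftable_row_mx d m n n' (A : 'M[option int]_(m, n))
    (B : 'M[option int]_(m, n')) :
  shiftable A -> shiftable B ->
  shiftable (row_mx (map_mx (shift_entry d) A) B).
Proof.
have posl i j : entry_pos (row_mx (map_mx (shift_entry d) A) B) i (lshift n' j) =
    entry_pos A i j by rewrite /entry_pos row_mxEl mxE; exact: shift_entry_pos.
have negl i j : entry_neg (row_mx (map_mx (shift_entry d) A) B) i (lshift n' j) =
    entry_neg A i j by rewrite /entry_neg row_mxEl mxE; exact: shift_entry_neg.
have posr i j : entry_pos (row_mx (map_mx (shift_entry d) A) B) i (rshift n j) =
    entry_pos B i j by rewrite /entry_pos row_mxEr.
have negr i j : entry_neg (row_mx (map_mx (shift_entry d) A) B) i (rshift n j) =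
    entry_neg B i j by rewrite /entry_neg row_mxEr.
have eq_card_set (I : finType) (P Q : pred I) :
  P =1 Q -> #|[set i | P i]| = #|[set i | Q i]| by move=> /eq_finset ->.
move=> [rowA colA] [rowB colB]; split=> [i|j].
  rewrite !card_split_ord (eq_card_set _ _ _ (posl i)) (eq_card_set _ _ _ (posr i)).
  by rewrite (eq_card_set _ _ _ (negl i)) (eq_card_set _ _ _ (negr i)) rowA rowB.
case: (split_ordP j) => {}j ->.
  rewrite (eq_card_set _ _ _ (posl^~ j)) (eq_card_set _ _ _ (negl^~ j)).
  exact: colA.
rewrite (eq_card_set _ _ _ (posr^~ j)) (eq_card_set _ _ _ (negr^~ j)).
exact: colB.
Qed.

Lemma SMR_row_mx m n n' r r' s (A : 'M[option int]_(m, n))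
    (B : 'M[option int]_(m, n')) :
  ~~ odd (m * r) -> ~~ odd (m * r') ->
  is_SMR r s A -> shiftable A -> is_SMR r' s B ->
  is_SMR (r + r') s (row_mx (map_mx (shift_entry (m * r')./2) A) B).
Proof.
move=> evA evB smrA [rowA colA] smrB.
set h' := (m * r')./2; set C := row_mx _ _.
have Cl i j : C i (lshift n' j) = shift_entry h' (A i j) by rewrite row_mxEl mxE.
have Cr i j : C i (rshift n j) = B i j by rewrite row_mxEr.
have [cardrA cardcA _ sumrA sumcA] := smrA.
have [cardrB cardcB _ sumrB sumcB] := smrB.
have cardrC i : #|[set j | C i j != None]| = (r + r')%N.
  rewrite card_split_ord -(cardrA i) -(cardrB i); congr (_ + _)%N.
    by congr #|pred_of_set _|; apply/setP=> j; rewrite !inE Cl shift_entry_eqNone.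
  by congr #|pred_of_set _|; apply/setP=> j; rewrite !inE Cr.
have sizeC : (m * (r + r'))%N = ((m * r)./2 + h').*2.
  by rewrite mulnDr doubleD !even_halfK.
split=> //.
- move=> j; case: (split_ordP j) => {}j ->.
    rewrite -(cardcA j); congr #|pred_of_set _|; apply/setP=> i.
    by rewrite !inE Cl shift_entry_eqNone.
  by rewrite -(cardcB j); congr #|pred_of_set _|; apply/setP=> i; rewrite !inE Cr.
- rewrite sizeC; apply: symbols_once.
    by rewrite (card_cells (P := fun i j => C i j != None) cardrC).
  move=> x; rewrite inE odd_double doubleK => xX.
  (* Symbols of absolute value at most [h'] are found in [B]; larger ones come from [A], after
     undoing the shift. *)
  have [lex|ltx] := leqP `|x| h'.
    have [|p pE] := SMR_symbol_occurs (x := x) smrB.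
      by rewrite inE (negbTE evB); lia.
    by exists (p.1, rshift n p.2); rewrite /= Cr.
  have [|p pE] := SMR_symbol_occurs (x := x - Num.sg x * h'%:Z) smrA.
    by rewrite inE (negbTE evA); case: sgrP; lia.
  exists (p.1, lshift n' p.2); rewrite /= Cl pE /=; congr Some.
  (* Since [|x| > h'], moving [x] towards 0 by [h'] does not change its sign, so shifting again
     gives back [x]. *)
  have -> : Num.sg (x - Num.sg x * h'%:Z) = Num.sg x.
    case: (sgrP x) => hx; [lia | apply/gtr0_sg; lia | apply/ltr0_sg; lia].
  by rewrite subrK.
- move=> i; rewrite big_split_ord /=.
  under eq_bigr do rewrite Cl.
  under [X in _ + X]eq_bigr do rewrite Cr.
  by rewrite sumrB sum_shift_entry ?sumrA ?addr0 //; apply: rowA.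
- move=> j; case: (split_ordP j) => {}j ->.
    under eq_bigr do rewrite Cl.
    by rewrite sum_shift_entry ?sumcA //; apply: colA.
  by under eq_bigr do rewrite Cr; rewrite sumcB.
Qed.

Lemma shiftable_SMR_even m n n' r r' s (A : 'M[option int]_(m, n))
    (B : 'M[option int]_(m, n')) :
  (0 < m)%N -> (0 < r')%N -> ~~ odd (m * r') ->
  is_SMR r s A -> shiftable A -> is_SMR r' s B -> ~~ odd (m * r).
Proof.
move=> m_gt0 r'_gt0 evB smrA [rowA _] smrB; apply/negP => oddA.
have [cardrA _ onceA _ _] := smrA.
have zero_in_row i : exists j, A i j = Some 0.
  suff /existsP[j /eqP]: [exists j, A i j == Some 0] by exists j.
  move: oddA; apply: contraTT; rewrite negb_exists => /forallP no0.
  rewrite oddM negb_and; apply/orP; right.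
  (* In a row without 0, every filled cell is positive or negative, and the two kinds are
     equinumerous. *)
  have -> : r = (#|[set j | entry_pos A i j]|).*2.
    rewrite -(cardrA i) -addnn {2}rowA -cardsUI.
    rewrite [X in (_ + X)%N](_ : _ = 0%N) ?addn0.
      congr #|pred_of_set _|; apply/setP=> j; move: (no0 j).
      rewrite !inE /entry_pos /entry_neg.
      by case: (A i j) => [x|] //=; case: (ltgtP x 0) => [||->].
    apply/eqP; rewrite cards_eq0; apply/eqP/setP=> j.
    by rewrite !inE /entry_pos /entry_neg; case: (A i j) => [x|] //; lia.
  by rewrite odd_double.
have zeroX : 0 \in smr_symbols (m * r) by rewrite inE oddA.
(* Every row contains a 0, but 0 occurs only once in [A]. *)
have row_unique (i1 i2 : 'I_m) : i1 = i2.
  have [j1 E1] := zero_in_row i1; have [j2 E2] := zero_in_row i2.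
  have /eqP/cards1P[p pE] := onceA _ zeroX.
  have : (i1, j1) \in [set p] by rewrite -pE inE E1.
  have : (i2, j2) \in [set p] by rewrite -pE inE E2.
  by rewrite !inE => /eqP <- /eqP[].
(* As [m * r'] is positive and even, it is at least 2, so 1 is a symbol of [B]. It is alone in its
   column, whose sum is then 1. *)
have [|[i j] /= pE] := SMR_symbol_occurs (x := 1) smrB.
  by rewrite inE (negbTE evB); nia.
have [_ _ _ _ /(_ j)] := smrB.
rewrite (bigD1 i) //= pE big1 //= => i' /eqP[]; exact: row_unique.
Qed.

Theorem theorem6 (m n n' r r' s : nat)
    (m_gt0 : (0 < m)%N) (n_gt0 : (0 < n)%N) (n'_gt0 : (0 < n')%N)
    (r_gt0 : (0 < r)%N) (r'_gt0 : (0 < r')%N) (s_gt0 : (0 < s)%N)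
    (mr'_even : ~~ odd (m * r'))
    (A : 'M[option int]_(m, n)) (A_SMR : is_SMR r s A) (A_shift : shiftable A)
    (B : 'M[option int]_(m, n')) (B_SMR : is_SMR r' s B)
    (k : nat) (k_ge1 : (1 <= k)%N) :
  (exists C : 'M[option int]_(m, k * n + n'), is_SMR (k * r + r') s C) /\
  (shiftable B ->
   exists C : 'M[option int]_(m, k * n + n'),
     is_SMR (k * r + r') s C /\ shiftable C).
Proof.
have mr_even := shiftable_SMR_even m_gt0 r'_gt0 mr'_even A_SMR A_shift B_SMR.
(* A single array [C] witnesses both claims, so one induction suffices. *)
suff [C [smrC shC]] : exists C : 'M[option int]_(m, k * n + n'),
    is_SMR (k * r + r') s C /\ (shiftable B -> shiftable C).
  by split=> [|/shC]; exists C.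
(* The induction starts at [k = 0], where [B] itself is the array. *)
elim: k {k_ge1} => [|k [C [smrC shC]]]; first by exists B.
rewrite !mulSn -!addnA.
(* Each new copy of [A] is shifted past all symbols of the array [C] built so far. *)
exists (row_mx (map_mx (shift_entry (m * (k * r + r'))./2) A) C); split.
  apply: SMR_row_mx => //.
  by rewrite mulnDr oddD (negbTE mr'_even) addbF mulnCA oddM (negbTE mr_even) andbF.
by move=> /shC; apply: shiftable_row_mx.
Qed.
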